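(* Let $\mathcal{C}=\{S,A_1,A_2\}$ be a set of real symmetric $m\times m$ matrices with $S$ nonsingular. If $S^{-1}A_i$ has only real eigenvalues for $i=1,2$, and $[A_1,A_2]_S=0$, then $\mathcal{C}$ is TWSD-B.
   Context: For symmetric $A,B,S\in\mathbb{R}^{m\times m}$ with $S$ nonsingular, $[A,B]_S=S^{-1}AS^{-1}B-S^{-1}BS^{-1}A$. $\mathrm{SL}_m(\mathbb{R})$ is the group of real $m\times m$ matrices with determinant $1$; $\|\cdot\|$ is the Frobenius norm. A set $\{C_1,\dots,C_L\}$ of real symmetric $m\times m$ matrices is TWSD-B if there exist $P_k\in\mathrm{SL}_m(\mathbb{R})$ and diagonal matrices $D_k^{(1)},\dots,D_k^{(L)}\in\mathbb{R}^{m\times m}$ for $k\ge 1$ such that $\lim_{k\to\infty}\sum_{i=1}^L\|P_kC_iP_k^{\mathsf T}-D_k^{(i)}\|^2=0$ and $\|D_k^{(i)}\|$ is bounded uniformly in $i$ and $k$. *)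

(* Defs.v *)
From HB Require Import structures.
From mathcomp Require Import all_boot all_order all_algebra.
From mathcomp Require Export complex.
From mathcomp Require Import all_classical all_reals all_analysis.

Set Implicit Arguments.
Unset Strict Implicit.
Unset Printing Implicit Defensive.

Import Order.TTheory GRing.Theory Num.Theory.
Import numFieldNormedType.Exports.

Local Open Scope classical_set_scope.
Local Open Scope ring_scope.

(* The canonical norm `|A| on matrices is the sup norm, hence this definition. *)
Definition frobenius (R : realType) (m : nat) (A : 'M[R]_m) : R :=
  Num.sqrt (\sum_i \sum_j A i j ^+ 2).

Definition bracket (R : realType) (m : nat) (S A B : 'M[R]_m) : 'M[R]_m :=
  invmx S *m A *m invmx S *m B - invmx S *m B *m invmx S *m A.

(* Eigenvalues are taken in the complex numbers: a real matrix has only real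
   eigenvalues when every eigenvalue of its complexification is real. *)
Definition only_real_eigenvalues (R : realType) (m : nat) (A : 'M[R]_m) : Prop :=
  forall z : R[i], eigenvalue (map_mx (real_complex R) A) z -> complex.Im z = 0.

(* The finite set {C_1, ..., C_L} is given by an enumeration; repetitions are
   harmless. Sequences are indexed from 0 instead of 1. *)
Definition TWSD_B (R : realType) (m L : nat) (C : L.-tuple 'M[R]_m) : Prop :=
  exists (P : nat -> 'M[R]_m) (D : nat -> 'I_L -> 'M[R]_m),
    [/\ forall k, \det (P k) = 1,
        forall k i, is_diag_mx (D k i),
        (\sum_(i < L)
           frobenius (P k *m tnth C i *m (P k)^T - D k i) ^+ 2) @[k --> \oo]
          --> (0 : R)
      & exists M : R, forall k i, frobenius (D k i) <= M].

(* Main.v *)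
Require Import Defs.
From mathcomp Require Import all_boot all_order all_algebra.
From mathcomp Require Import all_classical all_reals all_analysis.
From mathcomp Require Import ring.

(** Why the theorem holds.

    Congruence [C |-> P *m C *m P^T] is a change of basis for bilinear forms,
    so the claim is that the closure of the orbit of a triple of forms under
    SL contains a triple of diagonal ones.  Lying in the closure of an orbit
    is transitive ([degenerates_trans]), which lets a diagonal triple be
    approached one reduction at a time, by induction on the dimension.  The
    argument handles any finite family [C] of forms for which the matrices
    [C i *m invmx S] commute and have real eigenvalues
    ([commuting_pencils_degenerate]).

    Such a family has a common real eigenvector: a row [v] with
    [v *m C i = l i *: (v *m S)] ([common_real_eigenvector]).  If [v] is not
    [S]-isotropic, then the line of [v] splits off orthogonally for [S] and for
    every [C i], and induction applies to its complement.  If [v] is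
    [S]-isotropic, choose [w] pairing to 1 with [v] and let [B] be a basis of
    the [S]-orthogonal complement of [v] and [w].  In the basis [v, w, B] a form
    [C i] pairs [v] with [w] only, by [l i].  Stretching [v] by [1/s] and
    shrinking [w] by [s] keeps that pairing and sends every other entry that
    involves [w] to 0 as [s] does ([isotropic_degeneration]), so that the family
    degenerates to the sum of [l i] times a hyperbolic plane, which is
    diagonalizable, and its restriction to [B].  This restriction is the form
    induced on the quotient of [v]-perp by [v], and it satisfies the induction
    hypothesis again ([commuting_pencils_complement]). *)

Set Implicit Arguments.
Unset Strict Implicit.
Unset Printing Implicit Defensive.

Import Order.TTheory GRing.Theory Num.Theory.
Import numFieldNormedType.Exports.

Local Open Scope ring_scope.

(** * Degenerations under congruence *)

Section Degeneration.
Variable R : realType.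

Definition entries_le m n (e : R) (X : 'M[R]_(m, n)) : Prop :=
  forall a b, `|X a b| <= e.

Lemma entries_leD m n d e (X Y : 'M[R]_(m, n)) :
  entries_le d X -> entries_le e Y -> entries_le (d + e) (X + Y).
Proof.
by move=> Xd Ye a b; rewrite mxE (le_trans (ler_normD _ _))// lerD.
Qed.

Lemma entries_leZ m n c e (X : 'M[R]_(m, n)) :
  0 <= c -> entries_le e X -> entries_le (c * e) (c *: X).
Proof. by move=> c0 Xe a b; rewrite mxE normrM ger0_norm// ler_wpM2l. Qed.

Lemma entries_leM m n p d e (X : 'M[R]_(m, n)) (Y : 'M[R]_(n, p)) :
  entries_le d X -> entries_le e Y -> entries_le (d * e *+ n) (X *m Y).
Proof.
move=> Xd Ye a b; rewrite mxE (le_trans (ler_norm_sum _ _ _))//.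
rewrite -[n in leRHS]card_ord -sumr_const.
by apply: ler_sum => j _; rewrite normrM ler_pM.
Qed.

Lemma entries_le_block m1 m2 n1 n2 e (A : 'M[R]_(m1, n1)) (B : 'M[R]_(m1, n2))
    (C : 'M[R]_(m2, n1)) (D : 'M[R]_(m2, n2)) :
  entries_le e A -> entries_le e B -> entries_le e C -> entries_le e D ->
  entries_le e (block_mx A B C D).
Proof.
move=> Ae Be Ce De a b.
by rewrite mxE; case: splitP => i _; rewrite mxE; case: splitP => j _.
Qed.

Lemma entries_le_family m n (I : finType) (X : I -> 'M[R]_(m, n)) :
  exists2 N, 0 <= N & forall i, entries_le N (X i).
Proof.
exists (\sum_i \sum_a \sum_b `|X i a b|).
  by do 3!apply: sumr_ge0 => ? _.
move=> i a b; rewrite (bigD1 i)//= (bigD1 a)//= (bigD1 b)//= -!addrA lerDl.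
by do 2?apply: addr_ge0; do ?apply: sumr_ge0 => ? _.
Qed.

(** Continuity of a fixed congruence, which lets one degeneration be composed
    with another. *)
Lemma congruence_bounded m n (P : 'M[R]_(m, n)) :
  exists2 K, 0 < K & forall e X, 0 <= e -> entries_le e X ->
    entries_le (K * e) (P *m X *m P^T).
Proof.
have [N N0 PN] := entries_le_family (fun _ : unit => P).
have PTN : entries_le N P^T by move=> a b; rewrite mxE; exact: (PN tt).
(* The summand 1 keeps the constant positive when [P] vanishes. *)
exists (N * N *+ n *+ n + 1); first by rewrite ltr_wpDl// !mulrn_wge0// mulr_ge0.
move=> e X e0 Xe a b.
apply: le_trans (entries_leM (entries_leM (PN tt) Xe) PTN a b) _.
by rewrite mulrDl mul1r !mulrnAl mulrAC lerDl.
Qed.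

(** Membership of [D] in the closure of the orbit of [C] under simultaneous
    congruence by matrices of determinant 1. *)
Definition degenerates (I : Type) n (C D : I -> 'M[R]_n) : Prop :=
  forall e, 0 < e -> exists2 P : 'M[R]_n, \det P = 1 &
    forall i, entries_le e (P *m C i *m P^T - D i).

(** Orbit closures are stable under the group, by continuity of a congruence:
    a [P] taking [D] close to [E] also takes a tuple close enough to [D] close
    to [E]. *)
Lemma degenerates_trans I n (D C E : I -> 'M[R]_n) :
  degenerates C D -> degenerates D E -> degenerates C E.
Proof.
move=> CD DE e e0.
have e20 : 0 < e / 2 by rewrite divr_gt0.
have [P detP PD] := DE _ e20.
have [K K0 KP] := congruence_bounded P.
have [Q detQ QC] := CD _ (divr_gt0 e20 K0).
exists (P *m Q); first by rewrite det_mulmx detP detQ mulr1.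
move=> i.
have -> : P *m Q *m C i *m (P *m Q)^T - E i =
    P *m (Q *m C i *m Q^T - D i) *m P^T + (P *m D i *m P^T - E i).
  by rewrite mulmxBr mulmxBl addrA subrK trmx_mul !mulmxA.
rewrite [e]splitr; apply: entries_leD; last exact: PD.
rewrite -[e / 2](divfK (lt0r_neq0 K0)) mulrC; apply: KP; last exact: QC.
by rewrite divr_ge0// ltW.
Qed.

Lemma congr_block_diag m n (P G : 'M[R]_m) (Q M : 'M[R]_n)
    (E : 'M[R]_(m, n)) (F : 'M[R]_(n, m)) :
  block_mx P 0 0 Q *m block_mx G E F M *m (block_mx P 0 0 Q)^T =
  block_mx (P *m G *m P^T) (P *m E *m Q^T) (Q *m F *m P^T) (Q *m M *m Q^T).
Proof.
rewrite tr_block_mx !mulmx_block !trmx0.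
by rewrite !(mulmx0, mul0mx, addr0, add0r).
Qed.

Lemma degenerates_block I k n (K : I -> 'M[R]_k) (C D : I -> 'M[R]_n) :
  degenerates C D ->
  degenerates (fun i => block_mx (K i) 0 0 (C i))
              (fun i => block_mx (K i) 0 0 (D i)).
Proof.
move=> CD e e0; have [P detP PD] := CD e e0.
exists (block_mx 1%:M 0 0 P); first by rewrite det_ublock det1 detP mul1r.
move=> i; rewrite congr_block_diag trmx1 !(mulmx0, mul0mx, mul1mx, mulmx1).
rewrite opp_block_mx add_block_mx !subrr.
by apply: entries_le_block => // a b; rewrite mxE normr0 ltW.
Qed.

(** Along a one-parameter family of congruences under which [D], [X] and [Y]
    have weights 0, 1 and 2, only the weight-zero part survives as [s] goes to
    0. *)
Lemma degenerates_weights (I : finType) n (C D X Y : I -> 'M[R]_n) :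
  (forall s, 0 < s -> exists2 P : 'M[R]_n, \det P = 1 &
     forall i, P *m C i *m P^T = D i + s *: X i + s ^+ 2 *: Y i) ->
  degenerates C D.
Proof.
move=> CP e e0.
have [M M0 XM] := entries_le_family X.
have [N N0 YN] := entries_le_family Y.
have den0 : 0 < M + N + e by rewrite ltr_wpDl// addr_ge0.
(* The ratio is at most 1, so that the quadratic term is dominated by a linear
   one, and its product with [M + N] is at most [e]. *)
have s0 : 0 < e / (M + N + e) by rewrite divr_gt0.
have [P detP PC] := CP _ s0.
set s := e / _ in s0 PC.
have s1 : s <= 1 by rewrite ler_pdivrMr// mul1r lerDr addr_ge0.
exists P => // i; rewrite PC addrC !addrA addNr add0r => a b.
apply: le_trans (entries_leD (entries_leZ (ltW s0) (XM i))
  (entries_leZ (exprn_ge0 2 (ltW s0)) (YN i)) a b) _.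
apply: (@le_trans _ _ (s * (M + N))).
  by rewrite mulrDr lerD2l ler_wpM2r// expr2 ler_piMl// ltW.
by rewrite /s mulrAC ler_pdivrMr// ler_pM2l// lerDl ltW.
Qed.

Definition degenerates_to_diag (I : Type) n (C : I -> 'M[R]_n) : Prop :=
  exists2 D, (forall i, is_diag_mx (D i)) & degenerates C D.

(** The determinant constraint is harmless: the determinant of the congruence
    [Q] is compensated by rescaling the first basis vector, which preserves
    diagonal matrices. *)
Lemma degenerates_to_diag_congr I n (Q : 'M[R]_n) (C : I -> 'M[R]_n) :
  Q \in unitmx -> degenerates_to_diag (fun i => Q *m C i *m Q^T) ->
  degenerates_to_diag C.
Proof.
move=> unitQ [D diagD CD].
have [d detd] : exists d : 'rV[R]_n, \det (diag_mx d) * \det Q = 1.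
  case: n Q C unitQ D diagD CD => [|n] Q C unitQ D diagD CD.
    by exists 0; rewrite !det_mx00 mulr1.
  exists (\row_j if j == 0 then (\det Q)^-1 else 1).
  rewrite det_diag big_ord_recl big1 => [|j _]; last by rewrite mxE.
  by rewrite mxE mulr1 mulVf// -unitfE -unitmxE.
exists (fun i => diag_mx d *m D i *m (diag_mx d)^T).
  move=> i; apply/is_diag_mxP => a b ab.
  rewrite tr_diag_mx mul_mx_diag mul_diag_mx !mxE.
  by rewrite (is_diag_mxP (diagD i) _ _ ab) mulr0 mul0r.
move=> e e0.
have [K K0 KP] := congruence_bounded (diag_mx d).
have [P detP PD] := CD _ (divr_gt0 e0 K0).
exists (diag_mx d *m P *m Q).
  by rewrite !det_mulmx detP mulr1.
move=> i.
have -> : diag_mx d *m P *m Q *m C i *m (diag_mx d *m P *m Q)^T -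
    diag_mx d *m D i *m (diag_mx d)^T =
    diag_mx d *m (P *m (Q *m C i *m Q^T) *m P^T - D i) *m (diag_mx d)^T.
  by rewrite mulmxBr mulmxBl !trmx_mul !mulmxA.
rewrite -[e](divfK (lt0r_neq0 K0)) mulrC; apply: KP; last exact: PD.
by rewrite divr_ge0// ltW.
Qed.

Lemma frobenius_sqr_le n e (X : 'M[R]_n) :
  entries_le e X -> frobenius X ^+ 2 <= e ^+ 2 *+ n *+ n.
Proof.
move=> Xe; rewrite /frobenius sqr_sqrtr; last first.
  by do 2!apply: sumr_ge0 => ? _; exact: sqr_ge0.
have -> : e ^+ 2 *+ n *+ n = \sum_(a < n) \sum_(b < n) e ^+ 2.
  by rewrite !sumr_const card_ord.
apply: ler_sum => a _; apply: ler_sum => b _.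
rewrite -real_normK ?num_real// !expr2.
by apply: ler_pM.
Qed.

(** A fixed diagonal limit serves as the diagonal approximation for every
    index of the sequence. *)
Lemma degenerates_to_diag_TWSD_B n L (C : L.-tuple 'M[R]_n) :
  degenerates_to_diag (tnth C) -> TWSD_B C.
Proof.
move=> [D diagD CD].
have /choice[P PP] (k : nat) : exists P : 'M[R]_n, \det P = 1 /\
    forall i, entries_le k.+1%:R^-1 (P *m tnth C i *m P^T - D i).
  by have [|P] := CD k.+1%:R^-1; [rewrite invr_gt0 | exists P].
exists P, (fun=> D); split=> //; first by move=> k; case: (PP k).
- pose c : R := (n * n * L)%:R.
  apply: (@squeeze_cvgr _ _ _ _ (fun=> 0) (fun k => c * k.+1%:R^-1)).
  + apply: nearW => k; rewrite sumr_ge0/= => [|i _]; last exact: sqr_ge0.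
    have -> : c * k.+1%:R^-1 = \sum_(i < L) (k.+1%:R^-1 *+ n *+ n).
      by rewrite sumr_const card_ord /c mulr_natl !mulrnA.
    apply: ler_sum => i _; have [_ /(_ i) Pk] := PP k.
    apply: le_trans (frobenius_sqr_le Pk) _.
    by rewrite !lerMn2r !(expr2, ler_piMr, invf_le1, ler1n)// !orbT.
  + exact: cvg_cst.
  + rewrite -(mulr0 c); apply: cvgMr; exact: cvg_harmonic.
- exists (\sum_i frobenius (D i)) => k i.
  rewrite (bigD1 i)//= lerDl sumr_ge0// => j _; exact: sqrtr_ge0.
Qed.

End Degeneration.

(** * Commuting families of real pencils *)

Section Pencils.
Variable R : realType.
Local Notation cmx := (map_mx (real_complex R)).

(** Every root [z] of [\det (C - z *: S)] is real.  Phrased with eigenvectors of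
    the pencil rather than of [C *m invmx S], the condition is visibly invariant
    under congruence. *)
Definition real_pencil n (S C : 'M[R]_n) : Prop :=
  forall (z : R[i]) (y : 'rV[R[i]]_n), y != 0 ->
    y *m cmx C = z *: (y *m cmx S) -> complex.Im z = 0.

(** The fourth condition says that the matrices [C i *m invmx S], which are the
    endomorphisms associated with the forms [C i] through [S], commute. *)
Definition commuting_pencils (I : Type) n (S : 'M[R]_n) (C : I -> 'M[R]_n)
    : Prop :=
  [/\ S^T = S, S \in unitmx, forall i, (C i)^T = C i,
      forall i j, C i *m invmx S *m C j = C j *m invmx S *m C i &
      forall i, real_pencil S (C i)].

Lemma commuting_pencils_congr I n (Q S : 'M[R]_n) (C : I -> 'M[R]_n) :
  Q \in unitmx -> commuting_pencils S C ->
  commuting_pencils (Q *m S *m Q^T) (fun i => Q *m C i *m Q^T).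
Proof.
move=> unitQ [symS unitS symC commC realC].
have unitQT : Q^T \in unitmx by rewrite unitmx_tr.
have sym X : X^T = X -> (Q *m X *m Q^T)^T = Q *m X *m Q^T.
  by move=> symX; rewrite !trmx_mul trmxK symX mulmxA.
have invC i j : Q *m C i *m Q^T *m invmx (Q *m S *m Q^T) *m (Q *m C j *m Q^T) =
    Q *m (C i *m invmx S *m C j) *m Q^T.
  have -> : invmx (Q *m S *m Q^T) = invmx Q^T *m invmx S *m invmx Q.
    rewrite -[RHS]mulmx1 -(@mulmxV _ _ (Q *m S *m Q^T)).
      by rewrite !mulmxA (mulmxKV unitQ) (mulmxKV unitS) mulVmx// mul1mx.
    by rewrite !unitmx_mul unitQ unitS.
  by rewrite !mulmxA (mulmxK unitQT) (mulmxKV unitQ).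
split=> [||i|i j|i z y y0 yC].
- exact: sym.
- by rewrite !unitmx_mul unitQ unitS.
- exact: sym.
- by rewrite !invC commC.
- have cQ : cmx Q \in unitmx by rewrite map_unitmx.
  have cQT : cmx Q^T \in unitmx by rewrite map_unitmx.
  apply: (realC i z (y *m cmx Q)).
    by apply: contraNneq y0 => yQ; rewrite -(mulmxK cQ y) yQ mul0mx.
  rewrite -[LHS](mulmxK cQT) -[in RHS](mulmxK cQT (_ *m _ *m _)).
  by rewrite scalemxAl; congr (_ *m _); move: yC; rewrite !map_mxM/= !mulmxA.
Qed.

(** The matrices [C i *m invmx S] commute, so they share a complex eigenvector;
    its eigenvalues being real, its real and imaginary parts are eigenvectors
    too. *)
Lemma common_real_eigenvector (I : finType) n (S : 'M[R]_n) (C : I -> 'M[R]_n) :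
  (0 < n)%N -> commuting_pencils S C ->
  exists2 v : 'rV[R]_n, v != 0 &
    exists l : I -> R, forall i, v *m C i = l i *: (v *m S).
Proof.
move=> n0 [symS unitS symC commC realC].
have cS : cmx S \in unitmx by rewrite map_unitmx.
have [|v v0 /allP stab] := @common_eigenvector R[i] n
    [seq cmx (C i *m invmx S) | i <- enum I] n0.
  move=> _ _ /mapP[i _ ->] /mapP[j _ ->].
  by rewrite /comm_mx -!map_mxM !mulmxA commC.
have eig i : exists l : R, v *m cmx (C i) = (l%:C)%C *: (v *m cmx S).
  have /stab : cmx (C i *m invmx S) \in
      [seq cmx (C i *m invmx S) | i <- enum I]
    by apply/mapP; exists i; rewrite // mem_enum.
  move=> /sub_rVP[z vz].
  have vC : v *m cmx (C i) = z *: (v *m cmx S).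
    by rewrite scalemxAl -vz -mulmxA -map_mxM mulmxKV.
  exists (complex.Re z); rewrite vC; congr (_ *: _).
  by have := realC i z v v0 vC; case: (z) => a b /= ->.
have [l vl] := choice eig; clear eig stab.
(* The complex eigenvector relation has real coefficients, hence holds for the
   image of [v] under every real-linear [f], such as the real part. *)
have part (f : R[i] -> R) : {morph f : a b / a + b} -> f 0 = 0 ->
    (forall a x, f (a * x%:C%C) = f a * x) ->
    forall i, map_mx f v *m C i = l i *: (map_mx f v *m S).
  move=> fD f0 fM i.
  have fX (X : 'M[R]_n) : map_mx f (v *m cmx X) = map_mx f v *m X.
    apply/rowP => j; rewrite !mxE (big_morph f fD f0).
    by apply: eq_bigr => k _; rewrite !mxE fM.
  rewrite -!fX vl; apply/rowP => j.
  by rewrite !mxE [_ * \sum_(_ < _) _]mulrC fM mulrC.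
have [Rv0|Rv0] := eqVneq (map_mx (@complex.Re R) v) 0; last first.
  exists (map_mx (@complex.Re R) v) => //; exists l; apply: part => //.
  - by case=> a b [c d].
  - by case=> a b x /=; rewrite mulr0 subr0.
exists (map_mx (@complex.Im R) v); last first.
  exists l; apply: part => //.
  - by case=> a b [c d].
  - by case=> a b x /=; rewrite mulr0 add0r.
apply: contraNneq v0 => Iv0; apply/eqP/rowP => j.
move/rowP/(_ j): Rv0; move/rowP/(_ j): Iv0; rewrite !mxE.
by case: (v _ _) => a b /= -> ->.
Qed.

(** Splitting off a summand [K] of [S].  The hypotheses on [L] say that the
    off-diagonal blocks [E i] are represented through [K] by vectors [L i] which
    span a totally [K]-isotropic subspace and on which the pencil of [G i] and
    [K] is the scalar [l i].  Isotropy makes the contribution of [E i] and [E j]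
    to the lower right block of [C i *m invmx S *m C j] vanish, so commutation
    passes to [M].  It also lets an eigenvector [y] of the pencil of [M i] and
    [T] for a non-real value be lifted to one of the whole pencil. *)
Lemma commuting_pencils_complement I k n (K : 'M[R]_k) (T : 'M[R]_n)
    (G : I -> 'M[R]_k) (E : I -> 'M[R]_(k, n)) (M : I -> 'M[R]_n)
    (l : I -> R) (L : I -> 'M[R]_(n, k)) :
  (forall i, L i *m K = (E i)^T) -> (forall i, L i *m G i = l i *: (E i)^T) ->
  (forall i j, L i *m E j = 0) ->
  commuting_pencils (block_mx K 0 0 T)
    (fun i => block_mx (G i) (E i) (E i)^T (M i)) ->
  commuting_pencils T M.
Proof.
move=> LK LG LE [symS unitS symC commC realC].
have [unitK unitT] : K \in unitmx /\ T \in unitmx.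
  by apply/andP; move: unitS; rewrite !unitmxE det_ublock unitrM.
have invS : invmx (block_mx K 0 0 T) = block_mx (invmx K) 0 0 (invmx T).
  apply: (can_inj (mulmxK unitS)); rewrite mulVmx// mulmx_block.
  by rewrite !(mulmx0, mul0mx, addr0, add0r) !mulVmx// -scalar_mx_block.
split=> [//|//|i|i j|i z y y0 yM].
- by move: symS; rewrite tr_block_mx => /eq_block_mx[_ _ _].
- by move: (symC i); rewrite tr_block_mx => /eq_block_mx[_ _ _].
- have EK a b : (E a)^T *m invmx K *m E b = 0.
    by rewrite -LK (mulmxK unitK) LE.
  move: (commC i j); rewrite invS !mulmx_block => /eq_block_mx[_ _ _].
  by rewrite !(mulmx0, mul0mx, addr0, add0r) !EK !add0r.
- apply/eqP; apply: contraT => Imz.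
  have zl : (l i)%:C%C - z != 0.
    by apply: contraNneq Imz => /subr0_eq <-.
  (* This first component cancels [y *m (E i)^T]; by isotropy it adds nothing to
     the second component. *)
  pose x := - ((l i)%:C%C - z)^-1 *: (y *m cmx (L i)).
  case/eqP: Imz; apply: (realC i z (row_mx x y)).
    by apply: contraNneq y0; rewrite -row_mx0 => /eq_row_mx[_ ->].
  rewrite !map_block_mx !mul_row_block scale_row_mx !raddf0.
  rewrite !(mulmx0, addr0, add0r) -yM /x.
  rewrite -!scalemxAl -!mulmxA -!map_mxM LE LG LK map_mx0 mulmx0 scaler0 add0r.
  congr row_mx; rewrite map_mxZ -scalemxAr !scalerA -[X in _ + X]scale1r -scalerDl.
  by congr (_ *: _); field.
Qed.

(** A nondegenerate subspace meets its orthogonal complement, the kernel of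
    [S *m U^T], trivially, so bases of the two together form a basis. *)
Lemma orthogonal_completion k n (S : 'M[R]_(k + n)) (U : 'M[R]_(k, k + n)) :
  S^T = S -> U *m S *m U^T \in unitmx ->
  exists2 B : 'M[R]_(n, k + n), U *m S *m B^T = 0 & col_mx U B \in unitmx.
Proof.
move=> symS unitK; set W := S *m U^T.
have rankW : \rank W = k.
  apply/eqP; rewrite eqn_leq rank_leq_col/=.
  apply: leq_trans (mxrankM_maxr U W).
  by rewrite mulmxA mxrank_unit.
have : exists B : 'M[R]_(\rank (kermx W), k + n), (B :=: kermx W)%MS.
  by exists (row_base (kermx W)); exact: eq_row_base.
rewrite mxrank_ker rankW addKn => -[B BW].
have BS : B *m W = 0 by apply/eqP; rewrite -sub_kermx BW.
have freeB : row_free B.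
  by rewrite /row_free BW mxrank_ker rankW addKn.
exists B; first by apply: trmx_inj; rewrite !trmx_mul trmxK symS trmx0.
rewrite -row_free_unit; apply: inj_row_free => x.
rewrite -[x]hsubmxK mul_row_col => xUB.
have x10 : lsubmx x = 0.
  rewrite -[lsubmx x](mulmxK unitK) -[U *m S *m U^T]mulmxA -/W mulmxA.
  move/(congr1 (mulmx^~ W)): xUB; rewrite mulmxDl -[_ *m B *m W]mulmxA BS.
  by rewrite mulmx0 addr0 mul0mx => ->; rewrite mul0mx.
move: xUB; rewrite x10 mul0mx add0r => /eqP.
by rewrite mulmx_free_eq0// => /eqP ->; rewrite row_mx0.
Qed.

Lemma congr_col_mx k n p (U : 'M[R]_(k, p)) (B : 'M[R]_(n, p)) (X : 'M[R]_p) :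
  X^T = X ->
  col_mx U B *m X *m (col_mx U B)^T =
  block_mx (U *m X *m U^T) (U *m X *m B^T) (U *m X *m B^T)^T (B *m X *m B^T).
Proof.
move=> symX; rewrite mul_col_mx tr_col_mx mul_col_row.
by rewrite !trmx_mul trmxK symX mulmxA.
Qed.

End Pencils.

(** * Reduction to diagonal forms *)

Section Reduction.
Variables (R : realType) (I : finType).

(** The first two basis vectors [v] and [w] span a plane on which [C i] is
    [l i] times the hyperbolic plane, up to the value [c i] on [w].  Rescaling
    them to [s^-1 v] and [s w] gives [c i] weight 2 and [b i] weight 1.  The
    basis [P] is [s^-1 v + s w] and [(s w - s^-1 v) / 2], which has determinant 1
    and is orthogonal in the hyperbolic plane. *)
Lemma isotropic_degeneration n (l : I -> R) (c : I -> 'M[R]_1)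
    (b : I -> 'M[R]_(1, n)) (M : I -> 'M[R]_n) :
  degenerates
    (fun i => block_mx (block_mx 0 (l i)%:M (l i)%:M (c i)) (col_mx 0 (b i))
                       (col_mx 0 (b i))^T (M i))
    (fun i => block_mx (block_mx (2 * l i)%:M 0 0 (- (l i / 2))%:M) 0 0 (M i)).
Proof.
pose E i : 'M[R]_(1 + 1, n) := col_mx (b i) (2^-1 *: b i).
pose G i : 'M[R]_(1 + 1) :=
  block_mx (c i) (2^-1 *: c i) (2^-1 *: c i) (4^-1 *: c i).
apply: (degenerates_weights (X := fun i => block_mx 0 (E i) (E i)^T 0)
  (Y := fun i => block_mx (G i) 0 0 0)) => s s0.
have s_neq0 : s != 0 by rewrite gt_eqF.
pose P : 'M[R]_(1 + 1) :=
  block_mx s^-1%:M s%:M (- (s^-1 / 2))%:M (s / 2)%:M.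
have detP : \det P = 1.
  have -> : P = block_mx 1%:M 0 (- 2^-1)%:M 1%:M *m block_mx s^-1%:M s%:M 0 s%:M.
    rewrite mulmx_block !(mulmx0, mul0mx, mul1mx, mulmx1, addr0, add0r).
    by rewrite -!scalar_mxM -raddfD; congr block_mx; congr (_%:M); field.
  by rewrite det_mulmx det_lblock det_ublock det1 !det_scalar1 !mul1r mulVf.
have PG i : P *m block_mx 0 (l i)%:M (l i)%:M (c i) *m P^T =
    block_mx (2 * l i)%:M 0 0 (- (l i / 2))%:M + s ^+ 2 *: G i.
  rewrite /P /G [c i]mx11_scalar; set k := c i 0 0.
  rewrite tr_block_mx !tr_scalar_mx !mulmx_block scale_block_mx add_block_mx.
  rewrite !scale_scalar_mx !mulmx0 !add0r -!scalar_mxM -!raddfD -!scalar_mxM.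
  rewrite -!raddfD; congr block_mx; rewrite ?add0r; congr (_%:M); by field.
have PE i : P *m col_mx 0 (b i) = s *: E i.
  rewrite mul_block_col !mulmx0 !add0r !mul_scalar_mx scale_col_mx.
  by rewrite scalerA.
(* The block equations below concern the outer blocks only. *)
clearbody G E.
exists (block_mx P 0 0 1%:M); first by rewrite det_ublock detP det1 mul1r.
move=> i; rewrite congr_block_diag trmx1 !(mul1mx, mulmx1) PG PE.
rewrite -trmx_mul PE [(s *: _)^T]linearZ/= !scale_block_mx !add_block_mx !scaler0.
by rewrite !(addr0, add0r).
Qed.

(** As [v *m C i] is a multiple of [v *m S], the [S]-orthogonal complement of
    [v] is orthogonal to [v] for every [C i]: the line of [v] splits off. *)
Lemma degenerates_to_diag_nonisotropic n (S : 'M[R]_(1 + n))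
    (C : I -> 'M[R]_(1 + n)) (v : 'rV[R]_(1 + n)) (l : I -> R) :
  (forall T (M : I -> 'M[R]_n),
     commuting_pencils T M -> degenerates_to_diag M) ->
  commuting_pencils S C -> (forall i, v *m C i = l i *: (v *m S)) ->
  v *m S *m v^T != 0 -> degenerates_to_diag C.
Proof.
move=> IH SC vC vSv.
have [symS unitS symC _ _] := SC.
have unitK : v *m S *m v^T \in unitmx.
  rewrite unitmxE det_mx11 unitfE; apply: contraNneq vSv => vSv0.
  by rewrite [v *m S *m v^T]mx11_scalar vSv0 raddf0.
have [B vSB unitQ] := orthogonal_completion symS unitK.
have vCB i : v *m C i *m B^T = 0.
  by rewrite vC -scalemxAl vSB scaler0.
have QC : (fun i => col_mx v B *m C i *m (col_mx v B)^T) =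
    fun i => block_mx (v *m C i *m v^T) 0 0 (B *m C i *m B^T).
  by apply/funext => i; rewrite congr_col_mx// vCB trmx0.
have := commuting_pencils_congr unitQ SC.
rewrite QC congr_col_mx// vSB trmx0 => SC'.
have TM : commuting_pencils (B *m S *m B^T) (fun i => B *m C i *m B^T).
  apply: (@commuting_pencils_complement _ _ _ _ (v *m S *m v^T) _
    (fun i => v *m C i *m v^T) (fun=> 0) _ (fun=> 0) (fun=> 0)).
  - by move=> i; rewrite mul0mx trmx0.
  - by move=> i; rewrite mul0mx trmx0 scaler0.
  - by move=> i j; rewrite mulmx0.
  - by rewrite trmx0.
have [D diagD MD] := IH _ _ TM.
apply: (degenerates_to_diag_congr unitQ); rewrite QC.
exists (fun i => block_mx (v *m C i *m v^T) 0 0 (D i)).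
  move=> i; rewrite is_diag_block_mx// !eqxx diagD andbT/=.
  by apply/is_diag_mxP => a b; rewrite !ord1 eqxx.
exact: degenerates_block.
Qed.

(** The vectors [v] and [w] span an [S]-nondegenerate plane, but only [v] is
    orthogonal for [C i] to the complement [B] of that plane.  The remaining
    block, between [w] and [B], is represented by multiples of the isotropic
    [v], so that [commuting_pencils_complement] applies, and it vanishes in the
    limit given by [isotropic_degeneration]. *)
Lemma degenerates_to_diag_isotropic n (S : 'M[R]_(1 + 1 + n))
    (C : I -> 'M[R]_(1 + 1 + n)) (v w : 'rV[R]_(1 + 1 + n)) (l : I -> R) :
  (forall T (M : I -> 'M[R]_n),
     commuting_pencils T M -> degenerates_to_diag M) ->
  commuting_pencils S C -> (forall i, v *m C i = l i *: (v *m S)) ->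
  v *m S *m v^T = 0 -> v *m S *m w^T = 1%:M -> degenerates_to_diag C.
Proof.
move=> IH SC vC vSv vSw.
have [symS unitS symC _ _] := SC.
pose U := col_mx v w.
have US : U *m S *m U^T = block_mx 0 1%:M 1%:M (w *m S *m w^T).
  by rewrite congr_col_mx// vSv vSw trmx1.
have UC i : U *m C i *m U^T = block_mx 0 (l i)%:M (l i)%:M (w *m C i *m w^T).
  by rewrite congr_col_mx// vC -!scalemxAl vSv vSw scaler0 scalemx1 tr_scalar_mx.
have unitK : U *m S *m U^T \in unitmx.
  rewrite -row_free_unit; apply: inj_row_free => x.
  rewrite US -[x]hsubmxK mul_row_block !(mulmx0, mulmx1, add0r) -row_mx0.
  by move=> /eq_row_mx[->]; rewrite mul0mx addr0 => ->.
have [B USB unitQ] := orthogonal_completion symS unitK.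
have [vSB wSB] : v *m S *m B^T = 0 /\ w *m S *m B^T = 0.
  by apply/eq_col_mx; rewrite col_mx0 -!mul_col_mx.
have UCB i : U *m C i *m B^T = col_mx 0 (w *m C i *m B^T).
  by rewrite !mul_col_mx vC -!scalemxAl vSB scaler0.
have QC : (fun i => col_mx U B *m C i *m (col_mx U B)^T) =
    fun i => block_mx (block_mx 0 (l i)%:M (l i)%:M (w *m C i *m w^T))
      (col_mx 0 (w *m C i *m B^T)) (col_mx 0 (w *m C i *m B^T))^T
      (B *m C i *m B^T).
  by apply/funext => i; rewrite congr_col_mx// UC UCB.
have := commuting_pencils_congr unitQ SC.
rewrite QC congr_col_mx// USB trmx0 US => SC'.
have TM : commuting_pencils (B *m S *m B^T) (fun i => B *m C i *m B^T).
  apply: (commuting_pencils_complement (l := l)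
    (L := fun i => row_mx (w *m C i *m B^T)^T 0)) SC'.
  - move=> i; rewrite mul_row_block tr_col_mx trmx0.
    by rewrite !(mulmx0, mul0mx, mulmx1, addr0).
  - move=> i; rewrite mul_row_block tr_col_mx trmx0 scale_row_mx scaler0.
    by rewrite !(mulmx0, mul0mx, addr0) mul_mx_scalar.
  - by move=> i j; rewrite mul_row_col mulmx0 mul0mx addr0.
have [D diagD MD] := IH _ _ TM.
apply: (degenerates_to_diag_congr unitQ); rewrite QC.
exists (fun i => block_mx (block_mx (2 * l i)%:M 0 0 (- (l i / 2))%:M) 0 0 (D i)).
  by move=> i; rewrite !is_diag_block_mx// !eqxx diagD andbT/= !scalar_mx_is_diag.
apply: degenerates_trans (isotropic_degeneration _ _ _ _) _.
exact: degenerates_block.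
Qed.

Lemma commuting_pencils_degenerate n (S : 'M[R]_n) (C : I -> 'M[R]_n) :
  commuting_pencils S C -> degenerates_to_diag C.
Proof.
have [N] := ubnP n; elim: N n S C => // N IHN [|n] S C; rewrite ltnS => nN SC.
  exists C => [i|e e0]; first by apply/is_diag_mxP => -[].
  by exists 1%:M => [|i []//]; rewrite det1.
have [v v0 [l vC]] := common_real_eigenvector (ltn0Sn n) SC.
have [vSv|] := eqVneq (v *m S *m v^T) 0; last first.
  by apply: degenerates_to_diag_nonisotropic SC vC => T M; exact: IHN.
have [symS unitS _ _ _] := SC.
have [j vSj] : exists j, (v *m S) 0 j != 0.
  apply/rV0Pn; apply: contraNneq v0 => vS.
  by rewrite -(mulmxK unitS v) vS mul0mx.
pose w : 'rV[R]_n.+1 := ((v *m S) 0 j)^-1 *: delta_mx 0 j.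
have vSw : v *m S *m w^T = 1%:M.
  rewrite linearZ/= -scalemxAr trmx_delta -colE [col _ _]mx11_scalar !mxE.
  by rewrite scale_scalar_mx mulVf//; move: vSj; rewrite mxE.
case: n => [|n] in S C nN SC v v0 vC vSv symS unitS j vSj w vSw *.
  (* In dimension 1, [w] is a multiple of the isotropic [v]. *)
  have v00 : v 0 0 != 0.
    by apply: contraNneq v0 => v00; rewrite [v]mx11_scalar v00 raddf0.
  have wv : w = (w 0 0 / v 0 0) *: v.
    by apply/rowP => a; rewrite ord1 [RHS]mxE divfK.
  move: vSw; rewrite wv linearZ/= -scalemxAr vSv scaler0 => /matrixP/(_ 0 0)/eqP.
  by rewrite !mxE eq_sym oner_eq0.
apply: (@degenerates_to_diag_isotropic n S C v w l) => // T M.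
by apply: IHN; exact: ltnW.
Qed.

End Reduction.

Lemma only_real_eigenvalues_pencil (R : realType) n (S A : 'M[R]_n) :
  S \in unitmx -> only_real_eigenvalues (invmx S *m A) -> real_pencil S A.
Proof.
move=> unitS realA z y y0 yA; apply: realA.
have cS : map_mx (real_complex R) S \in unitmx by rewrite map_unitmx.
apply/eigenvalueP; exists (y *m map_mx (real_complex R) S).
  by rewrite -yA map_mxM mulmxA map_invmx mulmxK.
by apply: contraNneq y0 => yS; rewrite -(mulmxK cS y) yS mul0mx.
Qed.

Theorem theorem3p14 (R : realType) (m : nat) (S A1 A2 : 'M[R]_m)
    (symS : S^T = S) (symA1 : A1^T = A1) (symA2 : A2^T = A2)
    (unitS : S \in unitmx)
    (realA1 : only_real_eigenvalues (invmx S *m A1))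
    (realA2 : only_real_eigenvalues (invmx S *m A2))
    (commA : bracket S A1 A2 = 0) :
  TWSD_B [tuple S; A1; A2].
Proof.
have commA12 : A1 *m invmx S *m A2 = A2 *m invmx S *m A1.
  apply: (can_inj (mulKmx (_ : invmx S \in unitmx))); first by rewrite unitmx_inv.
  by rewrite !mulmxA; exact: subr0_eq.
have realS : real_pencil S S.
  move=> z y y0 yS.
  have cS : map_mx (real_complex R) S \in unitmx by rewrite map_unitmx.
  have /eqP : (1 - z) *: y = 0.
    by rewrite -(mulmxK cS (_ *: y)) -scalemxAl scalerBl scale1r -yS subrr mul0mx.
  by rewrite scaler_eq0 (negPf y0) orbF subr_eq0 => /eqP <-.
set C := [tuple S; A1; A2].
have memC i : tnth C i \in [:: S; A1; A2] by exact: mem_tnth.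
apply: degenerates_to_diag_TWSD_B.
apply: (@commuting_pencils_degenerate _ _ _ S); split=> // [i|i j|i].
- by have := memC i; rewrite !inE => /or3P[] /eqP ->.
- have := memC i; have := memC j; rewrite !inE.
  by do 2!case/or3P => /eqP ->; rewrite ?(mulmxK unitS) ?(mulmxV unitS)
    ?(mulmxKV unitS) ?mul1mx.
- by have := memC i; rewrite !inE => /or3P[] /eqP -> //;
    exact: only_real_eigenvalues_pencil.
Qed.
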